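(* Let $X$ be a Banach space. Suppose that there is a point $x\in S_X$ such that $x\notin\operatorname{ext}B_X$ and $\operatorname{ext}B_X\cap B(x,\varepsilon)\ne\emptyset$ for every $\varepsilon>0$. Then (a) $x$ fails property (co2); (b) $X$ fails property CWO-$S$; (c) whenever $K$ is a non-empty locally compact Hausdorff space, the space $C_0(K,X)$ fails property CWO-$S$.
   Context: Banach spaces are over the scalar field $\mathbb K$, where $\mathbb K=\mathbb R$ or $\mathbb K=\mathbb C$. $B_X$ and $S_X$ denote the closed unit ball and the unit sphere of $X$, $\operatorname{ext}B_X$ is the set of extreme points of $B_X$, and $B(x,\delta)=\{y\in X:\|y-x\|<\delta\}$. $C_0(K,X)$ is the Banach space of continuous functions $K\to X$ vanishing at infinity, with the supremum norm. A point $x\in B_X$ has property (co2) if: whenever $x_1,x_2\in B_X$ and $\lambda_1,\lambda_2>0$, $\lambda_1+\lambda_2=1$, are such that $x=\lambda_1x_1+\lambda_2x_2$, and $\varepsilon>0$, there is a $\delta>0$ such that, setting $B:=B(x,\delta)\cap B_X$, there are (norm-)continuous functions $\widehat v_1,\widehat v_2:B\to B_X$ such that for every $u\in B$ one has $u=\lambda_1\widehat v_1(u)+\lambda_2\widehat v_2(u)$ and $\|\widehat v_j(u)-x_j\|<\varepsilon$ for $j\in\{1,2\}$. A finite convex combination of relatively weakly open subsets of $B_X$ is a set $C=\sum_{j=1}^n\lambda_jU_j=\{\sum_{j=1}^n\lambda_ju_j: u_j\in U_j\}$, where $n\in\mathbb N$, each $U_j\subset B_X$ is open in the relative weak topology of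 $B_X$, $\lambda_j>0$ and $\sum_{j=1}^n\lambda_j=1$. The space $X$ has property CWO-$S$ if, for every such $C$, every $x\in C\cap S_X$ is an interior point of $C$ in the relative weak topology of $B_X$. *)

(* Defs.v *)
From HB Require Import structures.
From mathcomp Require Import all_boot all_order all_algebra complex.
From mathcomp Require Import all_classical all_reals all_analysis.

Set Implicit Arguments.
Unset Strict Implicit.
Unset Printing Implicit Defensive.

Import Order.TTheory GRing.Theory Num.Theory.
Import numFieldNormedType.Exports.

Local Open Scope classical_set_scope.
Local Open Scope ring_scope.

(* A normed module over [K : numFieldType] has a [K]-valued norm. When K = R[i],
   the order of K is such that [0 < z] means that z is a positive real, so that
   radii and convex coefficients may be taken in K itself. *)

Variant scalars := RealScalars | ComplexScalars.

Definition scalar_field (R : realType) (s : scalars) : numFieldType :=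
  match s with
  | RealScalars => R
  | ComplexScalars => R[i]
  end.

Definition unit_ball (K : numFieldType) (X : normedModType K) : set X :=
  [set x | `|x| <= 1].
Arguments unit_ball {K} X _.

Definition unit_sphere (K : numFieldType) (X : normedModType K) : set X :=
  [set x | `|x| = 1].
Arguments unit_sphere {K} X _.

Section NormedModule.
Context {K : numFieldType}.

Definition extreme_points (V : lmodType K) (A : set V) : set V :=
  [set x | A x /\ forall (y z : V) (t : K), A y -> A z -> 0 < t < 1 ->
     x = t *: y + (1 - t) *: z -> y = x /\ z = x].

(* The functions v1 and v2 are only relevant on B. *)
Definition property_co2 (X : normedModType K) (x : X) : Prop :=
  forall (x1 x2 : X) (l1 l2 e : K),
    unit_ball X x1 -> unit_ball X x2 ->
    0 < l1 -> 0 < l2 -> l1 + l2 = 1 -> x = l1 *: x1 + l2 *: x2 ->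
    0 < e ->
  exists2 d : K, 0 < d &
    let B := ball x d `&` unit_ball X in
    exists v1 v2 : X -> X,
      [/\ {within B, continuous v1}, {within B, continuous v2} &
          forall u, B u ->
            [/\ unit_ball X (v1 u), unit_ball X (v2 u),
                u = l1 *: v1 u + l2 *: v2 u,
                `|v1 u - x1| < e & `|v2 u - x2| < e]].

Definition dual_space (X : normedModType K) : Type :=
  {f : {linear X -> K^o} | continuous f}.

Definition weak_space (X : normedModType K) : Type := X.

HB.instance Definition _ (X : normedModType K) :=
  Topological.copy (weak_space X)
    (sup_topology (fun f : dual_space X =>
       Topological.class (initial_topology (sval f : X -> K^o)))).

Definition rel_weakly_open (X : normedModType K) (U : set X) : Prop :=
  exists2 V : set (weak_space X), open V & U = V `&` unit_ball X.

Definition convex_combination (V : lmodType K) (n : nat)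
    (l : 'I_n -> K) (U : 'I_n -> set V) : set V :=
  [set x | exists2 u : 'I_n -> V,
     (forall j, U j (u j)) & x = \sum_(j < n) l j *: u j].

Definition CWO_S (X : normedModType K) : Prop :=
  forall (n : nat) (l : 'I_n -> K) (U : 'I_n -> set X),
    (forall j, rel_weakly_open (U j)) ->
    (forall j, 0 < l j) -> \sum_(j < n) l j = 1 ->
  forall x : X, convex_combination l U x -> unit_sphere X x ->
  exists W : set X,
    [/\ rel_weakly_open W, W x & W `<=` convex_combination l U].

Definition vanishes_at_infinity (T : topologicalType) (X : normedModType K)
    (f : T -> X) : Prop :=
  forall e : K, 0 < e ->
    exists2 C : set T, compact C & forall t, ~ C t -> `|f t| < e.

End NormedModule.

(* Supremum of a set of nonnegative reals embedded in the scalar field *)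
Definition scalar_sup (R : realType) (s : scalars) :
    set (scalar_field R s) -> scalar_field R s :=
  match s return set (scalar_field R s) -> scalar_field R s with
  | RealScalars => fun A => sup A
  | ComplexScalars => fun A => (sup (@complex.Re R @` A))%:C%C
  end.

Lemma real_sup_ge0 (R : realType) (A : set R) :
  (forall a, A a -> 0 <= a) -> 0 <= sup A.
Proof.
move=> A0; have [[[a Aa] ubA]|/sup_out->//] := pselect (has_sup A).
by rewrite (le_trans (A0 _ Aa))// ub_le_sup.
Qed.

Lemma scalar_sup_ge0 (R : realType) s (A : set (scalar_field R s)) :
  (forall a, A a -> 0 <= a) -> 0 <= scalar_sup A.
Proof.
case: s A => A A0 /=; first exact: real_sup_ge0.
rewrite lecE /= eqxx /=; apply: real_sup_ge0 => _ [a /A0 + <-].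
by rewrite lecE => /andP[].
Qed.

Lemma scalar_sup_ub (R : realType) s (A : set (scalar_field R s)) M :
  (forall a, A a -> 0 <= a <= M) -> forall a, A a -> a <= scalar_sup A.
Proof.
case: s A M => A M AM a Aa /=.
  by apply: ub_le_sup => //; exists M => b /AM /andP[].
have /andP[] := AM _ Aa; rewrite !lecE /= => /andP[/eqP -> _] _.
rewrite eqxx /=; apply: ub_le_sup; last by exists a.
by exists (complex.Re M) => _ [b /AM /andP[_ +] <-]; rewrite lecE => /andP[].
Qed.

Lemma scalar_sup_le (R : realType) s (A : set (scalar_field R s)) M :
  0 <= M -> (forall a, A a -> a <= M) -> scalar_sup A <= M.
Proof.
case: s A M => A M M0 AM /=.
  have [->|/set0P A0] := eqVneq A set0; first by rewrite sup0.
  exact: ge_sup.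
move: M0; rewrite !lecE /= => /andP[-> M0] /=.
have [->|/set0P [a Aa]] := eqVneq A set0; first by rewrite image_set0 sup0.
apply: ge_sup; first by exists (complex.Re a), a.
by move=> _ [b /AM + <-]; rewrite lecE => /andP[].
Qed.

Section C0_module.
Context (K : numFieldType) (T : topologicalType) (X : normedModType K).

Definition C0_pred : {pred T -> X} :=
  mem [set f : T -> X | continuous f /\ vanishes_at_infinity f].

Lemma C0_submod_closed : submod_closed C0_pred.
Proof.
split=> [|a f g /set_mem[cf vf] /set_mem[cg vg]]; apply/mem_set; split.
- exact: cst_continuous.
- by move=> e e0; exists set0; [exact: compact0|move=> t _ /=; rewrite normr0].
- by move=> t; apply: continuousD; [apply: continuousZr; exact: cf|exact: cg].
- move=> e e0.
  have a0 : 0 < `|a| + 1 by rewrite ltr_wpDl.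
  have [C cC fC] := vf (e / 2 / (`|a| + 1)) (divr_gt0 (divr_gt0 e0 (ltr0Sn _ 1)) a0).
  have [D cD gD] := vg (e / 2) (divr_gt0 e0 (ltr0Sn _ 1)).
  exists (C `|` D); first exact: compactU.
  move=> t /not_orP[/fC ft /gD gt].
  rewrite (le_lt_trans (ler_normD _ _))// (splitr e) ler_ltD//=.
  rewrite normrZ; move: ft; rewrite ltr_pdivlMr// => /ltW; apply: le_trans.
  by rewrite mulrC ler_wpM2l// lerDl.
Qed.

HB.instance Definition _ :=
  GRing.isSubmodClosed.Build K (T -> X) C0_pred C0_submod_closed.

End C0_module.
Arguments C0_pred {K} T X.

Record C0 (K : numFieldType) (T : topologicalType) (X : normedModType K) := {
  C0_fun :> T -> X;
  C0_funP : C0_fun \in C0_pred T X }.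

Section C0_lmodule.
Context (K : numFieldType) (T : topologicalType) (X : normedModType K).

HB.instance Definition _ := [isSub of C0 T X for @C0_fun K T X].
HB.instance Definition _ := [Choice of C0 T X by <:].
HB.instance Definition _ := [SubChoice_isSubLmodule of C0 T X by <:].

Lemma C0_continuous (f : C0 T X) : continuous f.
Proof. by case: f => f /= /set_mem[]. Qed.

Lemma C0_vanishes (f : C0 T X) : vanishes_at_infinity f.
Proof. by case: f => f /= /set_mem[]. Qed.

Lemma C0_bounded (f : C0 T X) : exists M : K, forall t, `|f t| <= M.
Proof.
have [C cC fC] := C0_vanishes f ltr01.
have : \forall M \near +oo, forall t, C t -> `|f t| <= M.
  move/compact_near_coveringP: cC; apply => t Ct.
  have ft : \forall t' \near t, `|f t'| < `|f t| + 1.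
    have /cvgrPdist_lt/(_ 1 ltr01) := @C0_continuous f t.
    apply: filterS => t' /= ftt'.
    have := ler_normD (f t) (f t' - f t); rewrite addrC subrK => /le_lt_trans.
    by apply; rewrite ltrD2l distrC.
  have M1 : \forall M \near +oo, `|f t| + 1 < M.
    by apply: nbhs_pinfty_gt; rewrite ger0_real// addr_ge0.
  exists ([set t' | `|f t'| < `|f t| + 1], [set M | `|f t| + 1 < M]) => //=.
  by move=> [t' M] [/= ft' ltM]; rewrite ltW// (lt_trans ft').
move=> H.
have H1 : \forall M \near +oo, (1 : K) < M.
  by apply: nbhs_pinfty_gt; rewrite realE ler01.
have [M [M1 MC]] := filter_ex (filterI H1 H).
exists M => t; have [Ct|/fC ft] := pselect (C t); first exact: MC.
by rewrite ltW// (lt_trans ft).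
Qed.

End C0_lmodule.

Section C0_norm.
Context (R : realType) (s : scalars) (T : topologicalType).
Local Notation K := (scalar_field R s).
Implicit Types X : normedModType K.

Definition C0_norm X (f : C0 T X) : K := scalar_sup (range (fun t => `|f t|)).

Lemma C0_norm_ub X (f : C0 T X) t : `|f t| <= C0_norm f.
Proof.
have [M fM] := C0_bounded f.
by apply: (@scalar_sup_ub _ _ _ M) => [_ [x _ <-]|]; [rewrite normr_ge0 fM|exists t].
Qed.

Lemma C0_norm_le X (f : C0 T X) M :
  0 <= M -> (forall t, `|f t| <= M) -> C0_norm f <= M.
Proof. by move=> M0 fM; apply: scalar_sup_le => // _ [t _ <-]. Qed.

Lemma C0_norm_ge0 X (f : C0 T X) : 0 <= C0_norm f.
Proof. by apply: scalar_sup_ge0 => _ [t _ <-]. Qed.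

Lemma C0_normD X (f g : C0 T X) : C0_norm (f + g) <= C0_norm f + C0_norm g.
Proof.
apply: C0_norm_le => [|t]; first by rewrite addr_ge0 ?C0_norm_ge0.
by rewrite (le_trans (ler_normD _ _))// lerD ?C0_norm_ub.
Qed.

Lemma C0_normZ X (a : K) (f : C0 T X) : C0_norm (a *: f) = `|a| * C0_norm f.
Proof.
have le_normZ b g : C0_norm (b *: g : C0 T X) <= `|b| * C0_norm g.
  apply: C0_norm_le => [|t]; first by rewrite mulr_ge0 ?C0_norm_ge0.
  by rewrite normrZ ler_wpM2l ?C0_norm_ub.
apply/eqP; rewrite eq_le le_normZ /=.
have [->|a0] := eqVneq a 0; first by rewrite normr0 mul0r C0_norm_ge0.
rewrite -ler_pdivlMl ?normr_gt0//.
by rewrite -{1}(scalerK a0 f) (le_trans (le_normZ _ _))// normfV.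
Qed.

Lemma C0_norm_eq0 X (f : C0 T X) : C0_norm f = 0 -> f = 0.
Proof.
move=> f0; apply/val_inj/funext => t /=; apply/eqP.
by rewrite -normr_le0 -f0 C0_norm_ub.
Qed.

HB.instance Definition _ X :=
  Lmodule_isNormed.Build K (C0 T X) (@C0_normD X) (@C0_normZ X) (@C0_norm_eq0 X).

Lemma C0_complete (X : completeNormedModType K) (F : set_system (C0 T X)) :
  ProperFilter F -> cauchy F -> cvg F.
Proof.
move=> FF Fc.
have Fe (e : K) : 0 < e -> exists f0, F (fun f => forall t, `|f0 t - f t| < e).
  move=> e0; have [f0 Ff0] := (cauchyP F).1 Fc e e0.
  exists f0; apply: filterS Ff0 => f; rewrite -ball_normE /= => f0f t.
  by rewrite (le_lt_trans _ f0f)//; exact: (C0_norm_ub (f0 - f)).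
have cvt t : cvg ((fun f : C0 T X => f t) @ F).
  apply: cauchy_cvg; apply/cauchyP => e e0.
  have [f0 Ff0] := Fe e e0; exists (f0 t).
  apply: (@filterS _ F _ _ _ _ Ff0) => f f0f /=.
  by rewrite -ball_normE; exact: f0f.
pose g t : X := lim ((fun f : C0 T X => f t) @ F).
have Fg (e : K) : 0 < e -> exists2 f0 : C0 T X, (forall t, `|g t - f0 t| < e) &
    F (fun f => forall t, `|g t - f t| < e).
  move=> e0; have e2 : 0 < e / 2 by rewrite divr_gt0.
  have [f0 Ff0] := Fe (e / 2 / 2) (divr_gt0 e2 (ltr0Sn _ 1)).
  have Ff : F (fun f => forall t, `|g t - f t| < e).
    have Ff0' := Ff0; apply: filterS Ff0 => f f0f t.
    have /cvgrPdist_lt/(_ _ e2) gt := cvt t.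
    have [h [gh f0h]] := filter_ex (filterI gt Ff0').
    rewrite -(subrKA (h t)) (le_lt_trans (ler_normD _ _))// (splitr e) ltrD//.
    rewrite -(subrKA (f0 t)) (le_lt_trans (ler_normD _ _))//.
    rewrite (splitr (e / 2)) ltrD//; by rewrite distrC.
  by have [f] := filter_ex Ff; exists f.
have gC : g \in C0_pred T X.
  apply/mem_set; split.
    move=> t; apply/cvgrPdist_lt => e e0.
    have e3 : 0 < e / 2 / 2 by rewrite !divr_gt0.
    have [f gf _] := Fg _ e3.
    have /cvgrPdist_lt/(_ (e / 2)) := @C0_continuous _ _ _ f t.
    rewrite divr_gt0// => /(_ isT); apply: filterS => t' /= ftt'.
    rewrite -(subrKA (f t)) (le_lt_trans (ler_normD _ _))//.
    rewrite -(subrKA (f t') (f t)) (le_lt_trans (lerD (lexx _) (ler_normD _ _)))//.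
    rewrite addrCA (splitr e) ltrD// (splitr (e / 2)) ltrD//.
    by rewrite distrC.
  move=> e e0; have e2 : 0 < e / 2 by rewrite divr_gt0.
  have [f gf _] := Fg _ e2; have [C cC fC] := C0_vanishes f e2.
  exists C => // t /fC ft.
  by rewrite -(subrK (f t) (g t)) (le_lt_trans (ler_normD _ _))// (splitr e) ltrD.
apply/cvg_ex; exists (Build_C0 gC); apply/cvgrPdist_le => e e0.
have [_ _] := Fg e e0; apply: filterS => f gf.
by apply: C0_norm_le => [|t]; [exact: ltW|exact: ltW (gf t)].
Qed.

HB.instance Definition _ (X : completeNormedModType K) :=
  Uniform_isComplete.Build (C0 T X) (@C0_complete X).

End C0_norm.

(* Main.v *)
From HB Require Import structures.
Require Import Defs.
From mathcomp Require Import all_boot all_order all_algebra complex ring lra.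
From mathcomp Require Import all_classical all_reals all_analysis.

(** Let x be a norm-one point of the unit ball that is not extreme, say
    x = t y + (1 - t) z with y, z in the ball, y <> z and 0 < t < 1, while
    extreme points u accumulate at x. An extreme point has only the trivial
    decomposition u = t u + (1 - t) u, so no decomposition of u with the
    weights t and 1 - t has its two terms near y and near z.

    For (co2) this is a contradiction as soon as the two terms are asked to be
    within |y - z| / 2 of y and z ([not_property_co2]).

    For CWO-S, take a continuous functional f with f y <> f z, and disjoint
    open sets A and B of scalars around f y and f z. The combination
    C = t U + (1 - t) V of the slices U, V of the ball where f takes its values
    in A and in B contains x, but no extreme point of the ball. A weak
    neighbourhood of x is a norm neighbourhood, so it contains extreme points,
    and x is not interior to C.

    In C_0(T, X) fix a point t0 and a continuous compactly supported scalar
    function h with |h| <= 1 and h t0 = 1. Then u |-> h u is a linear isometry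
    from X into C_0(T, X) ([bump_scale]), and the argument is repeated with h x,
    h y, h z, h u and the functional g |-> f (g t0): although h u need not be
    extreme, evaluating a decomposition of h u at t0 gives a decomposition of u.
    Both cases are instances of [not_CWO_S_of_nearby].

    The functional f comes from the Hahn-Banach theorem ([hahn_banach]), which
    is proved by applying Zorn's lemma to sublinear functionals, the minimal
    ones being linear; a complex functional is recovered from its real part
    ([dual_separates_complex]). The function h comes from the complete
    regularity of locally compact Hausdorff spaces ([bump]). *)

Set Implicit Arguments.
Unset Strict Implicit.
Unset Printing Implicit Defensive.

Import Order.TTheory GRing.Theory Num.Theory.
Import numFieldNormedType.Exports.

Local Open Scope classical_set_scope.
Local Open Scope ring_scope.

(** * The Hahn-Banach theorem *)

Lemma le_infD (R : realType) (A B : set R) c : A !=set0 -> B !=set0 ->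
  (forall a b, A a -> B b -> c <= a + b) -> c <= inf A + inf B.
Proof.
move=> A0 B0 ABc; rewrite -lerBlDr; apply: lb_le_inf => // a Aa.
rewrite lerBlDr -lerBlDl; apply: lb_le_inf => // b Bb.
by rewrite lerBlDl ABc.
Qed.

Lemma le_infM (R : realType) (A : set R) a c : 0 < a -> A !=set0 ->
  (forall b, A b -> c <= a * b) -> c <= a * inf A.
Proof.
move=> a0 A0 Ac; rewrite -ler_pdivrMl//; apply: lb_le_inf => // b Ab.
by rewrite ler_pdivrMl// Ac.
Qed.

Section HahnBanach.
Context {R : realType} {V : lmodType R}.
Implicit Types p q : V -> R.

(** Homogeneity is required only as an inequality, which is what passes directly
    to infima; the equality follows, see [sublinearZ]. *)
Definition sublinear p :=
  (forall x y, p (x + y) <= p x + p y) /\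
  (forall a x, 0 <= a -> p (a *: x) <= a * p x).

Lemma sublinear_ge p x : sublinear p -> - p (- x) <= p x.
Proof.
move=> [pD _]; have := pD x (- x); have := pD 0 0.
rewrite subrr addr0; lra.
Qed.

Lemma sublinearZ p a x : sublinear p -> 0 <= a -> p (a *: x) = a * p x.
Proof.
move=> [pD pZ] a0; apply/eqP; rewrite eq_le pZ//=.
move: a0; rewrite le0r => /predU1P[->|a0].
  by rewrite mul0r scale0r; have := pD 0 0; rewrite addr0; lra.
have := pZ a^-1 (a *: x); rewrite scalerA mulVf ?gt_eqF// scale1r invr_ge0 ltW//.
by move=> /(_ isT); rewrite ler_pdivlMl.
Qed.

Lemma sublinear0 p : sublinear p -> p 0 = 0.
Proof. by move=> sp; rewrite -(scale0r 0) sublinearZ// mul0r. Qed.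

(** The largest sublinear functional that is below p and at most - p y at - y:
    a sublinear functional with these properties takes at x at most the value
    p (x + t *: y) - t * p y, for every t >= 0. It is used both to show that a
    minimal functional is additive and to prescribe a value. *)
Definition descent p y x :=
  inf [set p (x + t *: y) - t * p y | t in [set t | 0 <= t]].

Lemma descent_nonempty p y x :
  [set p (x + t *: y) - t * p y | t in [set t | 0 <= t]] !=set0.
Proof. by exists (p (x + 0 *: y) - 0 * p y), 0 => /=. Qed.

Lemma descent_le p y x t : sublinear p -> 0 <= t ->
  descent p y x <= p (x + t *: y) - t * p y.
Proof.
move=> sp t0; apply: ge_inf; last by exists t.
exists (- p (- x)) => _ [s /= s0 <-].
case: (sp) => pD _; have := pD (x + s *: y) (- x).
by rewrite addrAC subrr add0r sublinearZ//; lra.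
Qed.

Lemma sublinear_descent p y : sublinear p -> sublinear (descent p y).
Proof.
move=> sp; case: (sp) => pD pZ; split=> [x z|a x].
  apply: le_infD; [exact: descent_nonempty..|].
  move=> _ _ [s /= s0 <-] [t /= t0 <-].
  apply: le_trans (descent_le y (x + z) sp (addr_ge0 s0 t0)) _.
  have := pD (x + s *: y) (z + t *: y); rewrite addrACA -scalerDl; lra.
rewrite le0r => /predU1P[->|a0].
  apply: le_trans (descent_le y _ sp (lexx 0)) _.
  by rewrite !scale0r addr0 !mul0r subr0 sublinear0.
apply: le_infM => // [|_ [t /= t0 <-]]; first exact: descent_nonempty.
have at0 : 0 <= a * t by rewrite mulr_ge0// ltW.
apply: le_trans (descent_le y (a *: x) sp at0) _.
have := pZ a (x + t *: y) (ltW a0); rewrite scalerDr scalerA; lra.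
Qed.

(** The pointwise infimum of a chain of sublinear functionals below p is again
    sublinear; it is finite since q x >= - q (- x) >= - p (- x). *)
Lemma minimal_sublinear p : sublinear p ->
  exists q, [/\ sublinear q, forall x, q x <= p x &
    forall r, sublinear r -> (forall x, r x <= q x) -> forall x, q x <= r x].
Proof.
move=> sp; pose T := {q | sublinear q /\ forall x, q x <= p x}.
pose below (q r : T) := `[< forall x, sval r x <= sval q x >].
have belowP (q r : T) : below q r -> forall x, sval r x <= sval q x by move/asboolP.
have [||A Atot|[q [sq qp]] qmin] :=
    @ZL_preorder T (exist _ p (conj sp (fun x => lexx (p x)))) below.
- by move=> q; apply/asboolP.
- move=> r q s /belowP rq /belowP qs; apply/asboolP => x.
  exact: le_trans (qs x) (rq x).
- have [->|/set0P[q0 Aq0]] := eqVneq A set0.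
    by exists (exist _ p (conj sp (fun x => lexx (p x)))).
  pose values x := [set sval q x | q in A].
  have values0 x : values x !=set0 by exists (sval q0 x), q0.
  pose m x := inf (values x).
  have m_le (q : T) x : A q -> m x <= sval q x.
    move=> Aq; apply: ge_inf; last by exists q.
    exists (- p (- x)) => _ [[r [sr rp]] _ <-] /=.
    by rewrite (le_trans _ (sublinear_ge x sr))// lerN2.
  have sm : sublinear m.
    split=> [x y|a x].
      apply: le_infD => // _ _ [q Aq <-] [r Ar <-].
      (* A is a chain; by symmetry take r <= q, so that
         m (x + y) <= r x + r y <= q x + r y. *)
      wlog: q r x y Aq Ar / below q r => [sym|/belowP qr].
        have [/sym|/sym] := Atot _ _ Aq Ar; first exact.
        by rewrite addrC [leRHS]addrC; exact.
      apply: le_trans (m_le r _ Ar) _; case: (svalP r) => -[rD _] _.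
      by rewrite (le_trans (rD _ _))// lerD2r.
    rewrite le0r => /predU1P[->|a0].
      rewrite (le_trans (m_le q0 _ Aq0))//; case: (svalP q0) => -[_ qZ] _.
      by rewrite (le_trans (qZ _ _ _))// !mul0r.
    apply: le_infM => // _ [q Aq <-]; apply: le_trans (m_le q _ Aq) _.
    by case: (svalP q) => -[_ qZ] _; rewrite qZ// ltW.
  have mp x : m x <= p x.
    by rewrite (le_trans (m_le _ x Aq0))//; case: (svalP q0).
  exists (exist _ m (conj sm mp)) => q Aq; apply/asboolP => x /=; exact: m_le.
- exists q; split=> // r sr rq.
  have rp x : r x <= p x by rewrite (le_trans (rq x)).
  by have /belowP := qmin (exist _ r (conj sr rp)) (asboolT rq).
Qed.

(** A minimal sublinear q is linear: since descent q y <= q, minimality gives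
    q x <= q (x + y) - q y, so that q is additive. Choosing q below
    descent p x0 gives q (- x0) <= - p x0, hence q x0 = p x0. *)
Lemma hahn_banach p x0 : sublinear p ->
  exists f : {linear V -> R^o}, (forall x, f x <= p x) /\ f x0 = p x0.
Proof.
move=> sp.
have [q [sq qp0 qmin]] := minimal_sublinear (sublinear_descent x0 sp).
have qp x : q x <= p x.
  rewrite (le_trans (qp0 x))// (le_trans (descent_le x0 x sp (lexx 0)))//.
  by rewrite scale0r addr0 mul0r subr0.
have qD x y : q (x + y) = q x + q y.
  apply/eqP; rewrite eq_le; case: (sq) => -> _ /=.
  have le_descent z : descent q y z <= q z.
    rewrite (le_trans (descent_le y z sq (lexx 0)))//.
    by rewrite scale0r addr0 mul0r subr0.
  have := qmin _ (sublinear_descent y sq) le_descent x.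
  have := descent_le y x sq ler01; rewrite scale1r mul1r; lra.
have q0 : q 0 = 0 by have := qD 0 0; rewrite addr0; lra.
have qN x : q (- x) = - q x by have := qD x (- x); rewrite subrr q0; lra.
have qpos a x : 0 <= a -> q (a *: x) = a * q x.
  move=> a0; apply/eqP; rewrite eq_le; case: (sq) => _ qZ; rewrite qZ//=.
  by have := qZ a (- x) a0; rewrite scalerN !qN mulrN lerN2.
have qZ a x : q (a *: x) = a * q x.
  have [/qpos//|a0] := leP 0 a.
  by rewrite -[in LHS](opprK a) scaleNr qN qpos ?mulNr ?opprK// oppr_ge0 ltW.
have qlin : linear (q : V -> R^o) by move=> a x y; rewrite qD qZ.
pose linM := GRing.isLinear.Build _ _ _ _ _ qlin.
pose f : {linear V -> R^o} := HB.pack q linM.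
exists f; split=> //=; apply/eqP; rewrite eq_le qp /=.
have := qp0 (- x0); have := descent_le x0 (- x0) sp ler01.
rewrite scale1r addNr mul1r qN.
rewrite (sublinear0 sp); lra.
Qed.
End HahnBanach.

(** * Continuous functionals separate points *)

Section Realification.
Context {R : realType}.

(** A copy of the carrier, so that the real scalar multiplication does not
    compete with the complex one. *)
Definition realification (V : lmodType R[i]) : Type := V.

Section Lmodule.
Variable V : lmodType R[i].
HB.instance Definition _ := GRing.Zmodule.on (realification V).

Definition real_scale (a : R) (v : realification V) : realification V :=
  (a%:C%C *: (v : V) : V).

Lemma real_scaleA a b v : real_scale a (real_scale b v) = real_scale (a * b) v.
Proof. by rewrite /real_scale scalerA rmorphM. Qed.

Lemma real_scale1 : left_id 1 real_scale.
Proof. by move=> v; rewrite /real_scale rmorph1 scale1r. Qed.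

Lemma real_scaleDr : right_distributive real_scale +%R.
Proof. by move=> a v w; exact: scalerDr. Qed.

Lemma real_scaleDl v : {morph real_scale^~ v : a b / a + b}.
Proof. by move=> a b; rewrite /real_scale rmorphD scalerDl. Qed.

HB.instance Definition _ := GRing.Zmodule_isLmodule.Build R (realification V)
  real_scaleA real_scale1 real_scaleDr real_scaleDl.
End Lmodule.
End Realification.

Lemma dual_separates_real (R : realType) (X : normedModType R) (x : X) :
  x != 0 -> exists f : dual_space X, sval f x != 0.
Proof.
move=> x0.
have sn : sublinear (fun y : X => `|y|).
  by split=> [y z|a y a0]; rewrite ?ler_normD// normrZ ger0_norm.
have [f [fn fx]] := hahn_banach x sn.
have cf : continuous f.
  apply/bounded_linear_continuous/bounded_funP => r; exists r => y yr.
  apply: le_trans yr; rewrite ler_norml fn andbT lerNl -linearN.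
  by rewrite (le_trans (fn _))// normrN.
by exists (exist _ f cf); rewrite /= fx normr_eq0.
Qed.

(** A real-linear g bounded by the norm is the real part of the complex-linear
    functional F y = g y - i g (i y), so F x <> 0 because g x = |x|. *)
Lemma dual_separates_complex (R : realType) (X : normedModType R[i]) (x : X) :
  x != 0 -> exists f : dual_space X, sval f x != 0.
Proof.
move=> x0; pose p (y : realification X) : R := complex.Re `|y : X|.
have normE (y : X) : `|y| = (p y)%:C%C.
  have := normr_ge0 y; rewrite /p; case: (`|y|) => a b.
  by rewrite lecE /= => /andP[/eqP -> _].
have sp : sublinear p.
  split=> [y z|a y a0].
    by have := ler_normD (y : X) (z : X); rewrite !normE -rmorphD lecR.
  have := normrZ a%:C%C (y : X); rewrite !normE normc_def /= expr0n addr0.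
  by rewrite sqrtr_sqr ger0_norm// -rmorphM => -[->].
have [g [gp gx]] := hahn_banach (x : realification X) sp.
pose F (y : X) : R[i] := (g y)%:C%C - 'i%C * (g ('i%C *: y))%:C%C.
have gZ (a : R) (y : X) : g (a%:C%C *: y) = a * g y := linearZ_LR g a (y : realification X).
have gD (y z : X) : g (y + z) = g y + g z := linearD g (y : realification X) z.
have gN (y : X) : g (- y) = - g y := linearN g (y : realification X).
have Flin : linear (F : X -> R[i]^o).
  move=> [a b] y z; rewrite /F.
  have ab : (a +i* b)%C = a%:C%C + 'i%C * b%:C%C.
    by apply/eqP; rewrite eq_complex /=; apply/andP; split; apply/eqP; ring.
  rewrite ab.
  have -> : g ((a%:C%C + 'i%C * b%:C%C) *: y + z) = a * g y + b * g ('i%C *: y) + g z.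
    by rewrite gD scalerDl gD gZ ['i%C * _]mulrC -scalerA gZ.
  have -> : g ('i%C *: ((a%:C%C + 'i%C * b%:C%C) *: y + z)) =
      a * g ('i%C *: y) - b * g y + g ('i%C *: z).
    rewrite scalerDr gD scalerA mulrDr scalerDl gD mulrA -expr2 sqr_i mulN1r.
    by rewrite scaleNr gN gZ ['i%C * _]mulrC -scalerA gZ.
  by apply/eqP; rewrite eq_complex /=; apply/andP; split; apply/eqP; rewrite /=; ring.
pose linM := GRing.isLinear.Build _ _ _ _ _ Flin.
pose f : {linear X -> R[i]^o} := HB.pack F linM.
have g_le (y : X) : `|(g y)%:C%C : R[i]| <= `|y|.
  rewrite normc_def /= expr0n addr0 sqrtr_sqr normE lecR ler_norml gp andbT.
  rewrite lerNl -gN (le_trans (gp _))// /p.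
  by rewrite (normrN (y : X)).
have cf : continuous f.
  apply/bounded_linear_continuous/bounded_funP => r; exists (r + r) => y yr.
  rewrite (le_trans (ler_normB _ _))//= lerD ?(le_trans (g_le _))//.
  rewrite normrM (le_trans (ler_wpM2l (normr_ge0 _) (g_le _)))//.
  by rewrite normrZ mulrA -normrM -expr2 sqr_i normrN normr1 mul1r.
exists (exist _ f cf); rewrite /= /F; apply/eqP => /(congr1 (@complex.Re R)) /=.
rewrite gx; apply/eqP.
have : p x != 0 by apply: contra_neq x0 => px; apply/eqP; rewrite -normr_eq0 normE px.
by apply: contra_neq => <-; ring.
Qed.

Lemma dual_separates (R : realType) s (X : normedModType (scalar_field R s)) (x y : X) :
  x != y -> exists f : dual_space X, sval f x != sval f y.
Proof.
rewrite -subr_eq0.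
have : x - y != 0 -> exists f : dual_space X, sval f (x - y) != 0.
  case: s X x y => X x y; [exact: dual_separates_real|exact: dual_separates_complex].
by move=> /[apply] -[f]; rewrite linearB subr_eq0; exists f.
Qed.

(** * Convex combinations of weakly open sets *)

Section WeakTopology.
Context {K : numFieldType} {X : normedModType K}.

Lemma dual_weak_continuous (f : dual_space X) :
  continuous (sval f : weak_space X -> K^o).
Proof.
move=> x; have /cvg_sup/(_ f) xf : nbhs x --> (x : weak_space X) by exact: cvg_id.
exact: cvg_trans (cvg_app _ xf) (@initial_continuous X K^o (sval f) x).
Qed.

Lemma weak_open_open (V : set (weak_space X)) : open V -> open (V : set X).
Proof.
move=> oV; rewrite openE => x Vx.
suff : nbhs x --> (x : weak_space X) by apply; exact: open_nbhs_nbhs.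
apply/cvg_sup => f A /= [B [[C oC <-] /= Cfx]] /filterS; apply.
by apply: (svalP f x); exact: open_nbhs_nbhs.
Qed.

(** The points u stand for the extreme points near w, but are asked only that f
    does not distinguish the two terms of a decomposition; this weaker property
    is the one that the functions h u in C_0(T, X) have. *)
Lemma not_CWO_S_of_nearby (f : dual_space X) (w y z : X) (t : K) :
  unit_sphere X w -> unit_ball X y -> unit_ball X z -> 0 < t < 1 ->
  w = t *: y + (1 - t) *: z -> sval f y != sval f z ->
  (forall e : K, 0 < e -> exists2 u, (unit_ball X `&` ball w e) u &
     forall u1 u2, unit_ball X u1 -> unit_ball X u2 ->
       u = t *: u1 + (1 - t) *: u2 -> sval f u1 = sval f u2) ->
  ~ CWO_S X.
Proof.
move=> Sw By Bz /andP[t0 t1] wE fyz near_w cwo.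
have [[A B] /= [/set_mem Ay /set_mem Bfz] [oA oB /eqP AB0]] :
    exists2 AB : set K^o * set K^o, sval f y \in AB.1 /\ sval f z \in AB.2 &
      [/\ open AB.1, open AB.2 & AB.1 `&` AB.2 == set0].
  have := @norm_hausdorff K K^o; rewrite open_hausdorff; exact.
have weak_preimage (C : set K^o) : open C ->
    rel_weakly_open (sval f @^-1` C `&` unit_ball X).
  move=> oC; exists (sval f @^-1` C : set (weak_space X)) => //.
  by apply: open_comp => // x _; exact: dual_weak_continuous.
pose two S (a b : S) (j : 'I_2) := if j == ord0 then a else b.
pose U := two _ (sval f @^-1` A `&` unit_ball X) (sval f @^-1` B `&` unit_ball X).
have [||||W [[V oV ->] [Vw _] WC]] := cwo 2 (two _ t (1 - t)) U _ _ _ w _ Sw.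
- by move=> j; rewrite /U /two; case: ifP => _; exact: weak_preimage.
- by move=> j; rewrite /two; case: ifP; rewrite ?subr_gt0.
- by rewrite !big_ord_recl big_ord0 /two /= addr0 addrC subrK.
- exists (two _ y z); first by move=> j; rewrite /U /two; case: ifP.
  by rewrite !big_ord_recl big_ord0 /two /= addr0.
have := weak_open_open oV; rewrite openE => /(_ w Vw).
rewrite /interior -nbhs_ballE => -[e /= e0 eV].
have [u [Bu /eV Vu] fu] := near_w e e0.
have [v vU] : convex_combination (two _ t (1 - t)) U u by exact: WC.
rewrite !big_ord_recl big_ord0 /two /= addr0 => uE.
have [Av Bv] := vU ord0; have [Bv' Bv''] := vU (lift ord0 ord0).
have : (A `&` B) (sval f (v ord0)) by split=> //; rewrite (fu _ _ Bv Bv'' uE).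
by rewrite AB0.
Qed.

End WeakTopology.

(** * Extreme points near a point that is not extreme *)

Lemma not_extreme_split (K : numFieldType) (X : normedModType K) (x : X) :
  unit_ball X x -> ~ extreme_points (unit_ball X) x ->
  exists y z t, [/\ unit_ball X y, unit_ball X z, 0 < t < 1,
    x = t *: y + (1 - t) *: z & y != z].
Proof.
move=> Bx; apply: contra_notP => no_split; split=> // y z t By Bz t01 xE.
have yz : y = z.
  by apply/eqP/negPn/negP => yz; apply: no_split; exists y, z, t.
by rewrite xE -yz -scalerDl addrC subrK scale1r.
Qed.

(** The maps of (co2) send an extreme point u to u itself, so u would be closer
    than |y - z| / 2 both to y and to z. *)
Lemma not_property_co2 (K : numFieldType) (X : normedModType K) (x : X) :
  unit_ball X x -> ~ extreme_points (unit_ball X) x ->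
  (forall e : K, 0 < e -> extreme_points (unit_ball X) `&` ball x e !=set0) ->
  ~ property_co2 x.
Proof.
move=> Bx /(not_extreme_split Bx)[y [z [t [By Bz /andP[t0 t1] xE yz]]]] near_x co2.
have e0 : 0 < `|y - z| / 2 by rewrite divr_gt0// normr_gt0 subr_eq0.
have t1' : 0 < 1 - t by rewrite subr_gt0.
have [d d0 [v1 [v2 [_ _ vE]]]] :=
  co2 y z t (1 - t) _ By Bz t0 t1' (subrKC _ _) xE e0.
have [u [[Bu ext_u] du]] := near_x d d0.
have [Bv1 Bv2 uE] := vE u (conj du Bu).
have t01 : 0 < t < 1 by rewrite t0.
have [-> ->] := ext_u _ _ _ Bv1 Bv2 t01 uE => uy uz.
suff : `|y - z| < `|y - z| by rewrite ltxx.
by rewrite [ltRHS]splitr (le_lt_trans (ler_distD u y z))// ltrD// distrC.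
Qed.

(** * Embedding X into C_0(T, X) *)

Section Bump.
Context {R : realType} {s : scalars}.
Local Notation K := (scalar_field R s).
Context {T : topologicalType}.

Lemma scalar_embedding : exists h : R -> K,
  [/\ continuous h, h 0 = 0, h 1 = 1 & forall a, 0 <= a <= 1 -> `|h a| <= 1].
Proof.
case: s => /=.
  exists id; split=> // [a|a /andP[a0 a1]]; first exact: cvg_id.
  by rewrite ger0_norm.
exists (fun a => a%:C%C); split=> //; last first.
  move=> a /andP[a0 a1] /=.
  by rewrite normc_def /= expr0n addr0 sqrtr_sqr ger0_norm// lecR.
move=> a; apply/cvgrPdist_lt => -[e e'] /=; rewrite ltcE /= => /andP[/eqP -> e0].
have /cvgrPdist_lt/(_ _ e0) : b @[b --> a] --> a by exact: cvg_id.
apply: filterS => b ab; rewrite -rmorphB /= normc_def /= expr0n addr0 sqrtr_sqr.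
by rewrite ltcR.
Qed.

(** A point t0 is separated by a continuous function from the complement of the
    interior of a compact neighbourhood of t0. *)
Lemma bump (t0 : T) : locally_compact [set: T] -> hausdorff_space T ->
  exists h : T -> K, [/\ continuous h, h t0 = 1, forall t, `|h t| <= 1 &
    exists2 C, compact C & forall t, ~ C t -> h t = 0].
Proof.
move=> lcT hT; have := lcT t0 I; rewrite withinET => -[C nC [cC _]].
have : ~ (~` C^°) t0 by move=> /(_ nC).
have clC : closed (~` C^°) by apply: open_closedC; exact: open_interior.
move=> /(@locally_compact_completely_regular T R lcT hT t0 _ clC).
move=> /(@uniform_separatorP T R)[g [cg g01 gt0 gC]].
have [k [ck k0 k1 kle]] := scalar_embedding.
exists (fun t => k (1 - g t)); split.
- move=> t; apply: (@continuous_comp _ _ _ (fun t => 1 - g t) k); last exact: ck.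
  by apply: continuousB; [exact: cst_continuous|exact: cg].
- by rewrite (gt0 (g t0)) ?subr0//; exists t0.
- move=> t; apply: kle; have : range g (g t) by exists t.
  by move=> /g01 /=; rewrite in_itv /=; lra.
exists C => // t nCt; rewrite (gC (g t)) ?subrr//.
by exists t => // /interior_subset.
Qed.

End Bump.

Section EmbeddingByBump.
Context {R : realType} {s : scalars}.
Local Notation K := (scalar_field R s).
Context {T : topologicalType} {X : normedModType K}.
Context (h : T -> K) (t0 : T).
Context (ch : continuous h) (ht0 : h t0 = 1) (h_le1 : forall t, `|h t| <= 1).
Context (h_supp : exists2 C, compact C & forall t, ~ C t -> h t = 0).

Fact bump_scale_C0 (x : X) : (fun t => h t *: x) \in C0_pred T X.
Proof.
apply/mem_set; split=> [t|e e0]; first by apply: cvgZ; [exact: ch|exact: cvg_cst].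
by have [C cC hC] := h_supp; exists C => // t /hC ->; rewrite scale0r normr0.
Qed.

Definition bump_scale x : C0 T X := Build_C0 (bump_scale_C0 x).

Lemma bump_scale_linear : linear bump_scale.
Proof.
move=> a x y; apply/val_inj/funext => t /=.
by rewrite scalerDr scalerA mulrC -scalerA.
Qed.

Lemma bump_scale_norm x : `|bump_scale x| = `|x|.
Proof.
apply/eqP; rewrite eq_le; apply/andP; split.
  apply: C0_norm_le => // t /=.
  by rewrite normrZ ler_piMl.
by have := C0_norm_ub (bump_scale x) t0; rewrite /= ht0 scale1r.
Qed.
End EmbeddingByBump.

Section Evaluation.
Context {R : realType} {s : scalars}.
Local Notation K := (scalar_field R s).
Context {T : topologicalType} {X : normedModType K}.

Lemma dual_eval (t0 : T) (f : dual_space X) :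
  exists F : dual_space (C0 T X), forall g, sval F g = sval f (g t0).
Proof.
pose F (g : C0 T X) : K^o := sval f (g t0).
have Flin : linear F by move=> a g g'; rewrite /F -linearP.
pose linM := GRing.isLinear.Build _ _ _ _ _ Flin.
pose F' : {linear C0 T X -> K^o} := HB.pack F linM.
have cF : continuous F'.
  apply/bounded_linear_continuous/bounded_funP => r.
  have /linear_bounded_continuous/bounded_funP/(_ r)[M fM] := svalP f.
  by exists M => g gr; apply: fM; apply: le_trans gr; exact: C0_norm_ub.
by exists (exist _ F' cF).
Qed.
End Evaluation.

(** * The theorem *)

Theorem proposition3p3 (R : realType) (s : scalars)
    (X : completeNormedModType (scalar_field R s)) (x : X) :
  unit_sphere X x ->
  ~ extreme_points (unit_ball X) x ->
  (forall e : scalar_field R s, 0 < e ->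
     extreme_points (unit_ball X) `&` ball x e !=set0) ->
  [/\ ~ property_co2 x,
      ~ CWO_S X &
      forall T : topologicalType,
        [set: T] !=set0 -> locally_compact [set: T] -> hausdorff_space T ->
        ~ CWO_S (C0 T X)].
Proof.
move=> Sx next near_x.
have Bx : unit_ball X x by rewrite /unit_ball /= Sx.
have [y [z [t [By Bz t01 xE yz]]]] := not_extreme_split Bx next.
have [f fyz] := dual_separates yz.
split; first exact: not_property_co2.
  apply: (not_CWO_S_of_nearby (f := f) Sx By Bz t01 xE fyz) => e /near_x.
  move=> [u [[Bu ext_u] xu]]; exists u => // u1 u2 B1 B2 /(ext_u _ _ _ B1 B2 t01).
  by case=> -> ->.
move=> T [t0 _] lcT hT.
have [h [ch ht0 h1 hC]] := @bump R s T t0 lcT hT.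
have [F FE] := dual_eval t0 f.
pose b := @bump_scale R s T X h ch hC.
have bE u : b u t0 = u by rewrite /b /= ht0 scale1r.
have bN u : `|b u| = `|u| by exact: (bump_scale_norm ch ht0 h1 hC u).
have bP a u v : b (a *: u + v) = a *: b u + b v by exact: bump_scale_linear.
apply: (not_CWO_S_of_nearby (f := F) (w := b x) (y := b y) (z := b z) (t := t)) => //.
- by rewrite /unit_sphere /= bN.
- by rewrite /unit_ball /= bN.
- by rewrite /unit_ball /= bN.
- rewrite xE bP; congr (_ + _).
  have b0 : b 0 = 0 by apply/eqP; rewrite -normr_eq0 bN normr0.
  by rewrite -[(1 - t) *: z]addr0 bP b0 addr0.
- by rewrite !FE !bE.
move=> e /near_x[u [[Bu ext_u] xu]]; exists (b u).
  split; first by rewrite /unit_ball /= bN.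
  move: xu; rewrite -!ball_normE /=.
  have -> : b x - b u = b (x - u).
    by have := bP (-1) u x; rewrite !scaleN1r ![- _ + _]addrC => ->.
  by rewrite bN.
(* At t0 a decomposition of h u becomes one of u, which is trivial. *)
move=> g1 g2 B1 B2 /(congr1 (fun g : C0 T X => g t0)).
rewrite bE !FE /= => uE.
have [|||-> ->//] := ext_u (g1 t0) (g2 t0) t _ _ t01.
- exact: le_trans (C0_norm_ub _ _) B1.
- exact: le_trans (C0_norm_ub _ _) B2.
- exact: uE.
Qed.
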